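(* Suppose that $C=(C_\bullet,d,t)$ is a para-precyclic $k$-module and $k\supset\mathbb Q$. Then the $k$-linear map $\bar\nu^{\natural\natural}:C^\lambda_\bullet\to C^{\natural\natural}_{T,\bullet}$ is a chain map such that $$\bar\pi^{\natural\natural}\bar\nu^{\natural\natural}=1,\qquad \bar\nu^{\natural\natural}\bar\pi^{\natural\natural}=1+(\partial+\delta)\bar\varphi^{\natural\natural}+\bar\varphi^{\natural\natural}(\partial+\delta),\qquad \bar\pi^{\natural\natural}\bar\varphi^{\natural\natural}=0 .$$ In particular, we obtain a deformation retract of $C_T^{\natural\natural}$ to $C^\lambda$.
   Context: $k$ is a unital ring, not assumed commutative; $k$-modules are left modules. A para-precyclic $k$-module consists of $k$-modules $C_m$, $m\ge0$, face maps $d_j:C_m\to C_{m-1}$ ($0\le j\le m$) with $d_id_j=d_{j-1}d_i$ for $i<j$, and an invertible $k$-linear map $t:C_\bullet\to C_\bullet$ of degree $0$ with $td_i=d_{i+1}t$ for $0\le i\le m-1$ and $d_m=d_0t$ on $C_m$ (notation: $d=d_m$ on $C_m$). Put $T=t^{m+1}$ on $C_m$; it commutes with $d$ and $t$. It is precyclic if $T=1$. Let $b=\sum_{j=0}^m(-1)^jd_j$, $b'=\sum_{j=0}^{m-1}(-1)^jd_j$, $\tau=(-1)^mt$, $N=1+\tau+\cdots+\tau^m$ on $C_m$. Let $C_{T,\bullet}=C_\bullet/\operatorname{ran}(1-T)$, with canonical projection $\pi_T$; the induced structure makes it a precyclic module $C_T$. $C^{\natural\natural}_m=\bigoplus_{p+q=m}C_qu^p$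 ($p,q\ge0$, $u$ a formal variable), operators on $C_\bullet$ act on coefficients, $\partial(xu^{2p+1})=(1-\tau)xu^{2p}$, $\partial(xu^{2p})=Nxu^{2p-1}$ for $p\ge1$, $\partial(xu^0)=0$, $\delta(xu^{2p})=bxu^{2p}$, $\delta(xu^{2p+1})=-b'xu^{2p+1}$. $C_T^{\natural\natural}=(C_{T,\bullet}^{\natural\natural},\partial+\delta)$ is the same construction for $C_T$; it is a chain complex. $C^\lambda=(C^\lambda_\bullet,b)$, $C^\lambda_m=C_m/\operatorname{ran}(1-\tau)$, with $b$ induced by $b$ (since $b(1-\tau)=(1-\tau)b'$); $\pi^\lambda:C_\bullet\to C^\lambda_\bullet$ is the canonical projection. Let $\pi_0^{\natural\natural}:C^{\natural\natural}_\bullet\to C_\bullet$, $\pi_0^{\natural\natural}(xu^0)=x$, $\pi_0^{\natural\natural}(xu^p)=0$ for $p\ge1$, and $\pi^{\natural\natural}=\pi^\lambda\pi_0^{\natural\natural}$. For $x\in C_m$ put $\hat x=(m+1)^{-1}x$, $\hat Nx=N\hat x$, $\hat Dx=\sum_{j=0}^m(m-j)\tau^j\hat x$. Define $\nu(x)=\hat Nx\,u^0$ and $\varphi:C^{\natural\natural}_\bullet\to C^{\natural\natural}_{\bullet+1}$ by $\varphi(xu^{2p})=-\hat Dx\,u^{2p+1}$, $\varphi(xu^{2p+1})=-\hat x\,u^{2p+2}$. Set $\varphi^{\natural\natural}=\sum_{j\ge0}(\varphi\delta)^j\varphi$ and $\nu_0^{\natural\natural}=\sum_{j\ge0}(\varphi\delta)^j\nu:C_\bullet\to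 C^{\natural\natural}_\bullet$ (finite sums on each element). These descend: $\bar\pi^{\natural\natural}:C_{T,\bullet}^{\natural\natural}\to C^\lambda_\bullet$ with $\bar\pi^{\natural\natural}\pi_T=\pi^{\natural\natural}$; $\bar\nu^{\natural\natural}:C^\lambda_\bullet\to C_{T,\bullet}^{\natural\natural}$ with $\bar\nu^{\natural\natural}\pi^\lambda=\pi_T\nu_0^{\natural\natural}$; $\bar\varphi^{\natural\natural}:C_{T,\bullet}^{\natural\natural}\to C_{T,\bullet+1}^{\natural\natural}$ with $\bar\varphi^{\natural\natural}\pi_T=\pi_T\varphi^{\natural\natural}$ (where $\pi_T$ acts on coefficients). *)

(* Defs.v *)
From HB Require Import structures.
From mathcomp Require Import all_boot all_order all_algebra.
From mathcomp Require Import ring_quotient generic_quotient boolp.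

Set Implicit Arguments.
Unset Strict Implicit.
Unset Printing Implicit Defensive.

Import GRing.Theory.
Local Open Scope ring_scope.
Local Open Scope quotient_scope.

(* The quotient V / ran f.  Membership in ran f is made boolean classically. *)
Section QuotientByRange.
Variables (k : nzRingType) (U V : lmodType k) (f : {linear U -> V}).

Definition ran : {pred V} := fun x => `[< exists y, x = f y >].

Lemma ranP x : reflect (exists y, x = f y) (x \in ran).
Proof. exact: asboolP. Qed.

Lemma ran_zmod_closed : zmod_closed ran.
Proof.
split; first by apply/ranP; exists 0; rewrite linear0.
by move=> _ _ /ranP[x ->] /ranP[y ->]; apply/ranP; exists (x - y); rewrite linearB.
Qed.

HB.instance Definition _ := GRing.isZmodClosed.Build V ran ran_zmod_closed.

Definition quo := (Quotient.quot ran).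
HB.instance Definition _ := GRing.Zmodule.on quo.

Definition quo_class (x : V) : quo := \pi_(Quotient.quot ran) x.

Lemma quo_classE x y : (quo_class x = quo_class y) <-> (x - y \in ran).
Proof.
rewrite Quotient.idealrBE; split; first by move=> e; apply/eqP.
by move=> /eqP.
Qed.

Lemma quo_classD x y : quo_class (x + y) = quo_class x + quo_class y.
Proof. by rewrite /quo_class !piE. Qed.

Lemma quo_class_repr (q : quo) : quo_class (repr q) = q.
Proof. exact: reprK. Qed.

Definition quo_scale (a : k) (q : quo) : quo := quo_class (a *: repr q).

Lemma quo_scaleE a x : quo_scale a (quo_class x) = quo_class (a *: x).
Proof.
apply/quo_classE; rewrite -scalerBr.
have /quo_classE/ranP[y ->] := quo_class_repr (quo_class x).
by apply/ranP; exists (a *: y); rewrite linearZ.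
Qed.

Lemma quo_scalerA a b q : quo_scale a (quo_scale b q) = quo_scale (a * b) q.
Proof. by rewrite -[q]quo_class_repr !quo_scaleE scalerA. Qed.

Lemma quo_scale1r : left_id 1 quo_scale.
Proof. by move=> q; rewrite -[q]quo_class_repr !quo_scaleE scale1r. Qed.

Lemma quo_scalerDr : right_distributive quo_scale +%R.
Proof.
move=> a p q; rewrite -[p]quo_class_repr -[q]quo_class_repr.
by rewrite -quo_classD !quo_scaleE scalerDr quo_classD.
Qed.

Lemma quo_scalerDl q : {morph quo_scale^~ q : a b / a + b}.
Proof.
move=> a b; rewrite -[q]quo_class_repr.
by rewrite !quo_scaleE scalerDl quo_classD.
Qed.

HB.instance Definition _ := GRing.Zmodule_isLmodule.Build k quo
  quo_scalerA quo_scale1r quo_scalerDr quo_scalerDl.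

Lemma quo_class_linear : linear quo_class.
Proof. by move=> a x y; rewrite quo_classD -quo_scaleE. Qed.
HB.instance Definition _ :=
  GRing.isLinear.Build k V quo *:%R quo_class quo_class_linear.

Definition quo_proj : {linear V -> quo} := quo_class.

Lemma quo_proj_eq0 x : quo_proj x = 0 <-> exists y, x = f y.
Proof.
rewrite -[0](linear0 quo_proj) quo_classE subr0.
by split=> [/ranP|?]; last apply/ranP.
Qed.

Lemma quo_proj_surj (q : quo) : exists x, quo_proj x = q.
Proof. by exists (repr q); apply: quo_class_repr. Qed.

Section Lift.
Variables (W : lmodType k) (g : {linear V -> W}).
Hypothesis g_ran : forall y, g (f y) = 0.

Definition quo_lift_fun (q : quo) : W := g (repr q).

Lemma quo_lift_funE x : quo_lift_fun (quo_proj x) = g x.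
Proof.
apply/eqP; rewrite -subr_eq0 -linearB.
have /quo_classE/ranP[y ->] := quo_class_repr (quo_proj x).
by rewrite g_ran.
Qed.

Lemma quo_lift_linear : linear quo_lift_fun.
Proof.
move=> a p q; have [x <-] := quo_proj_surj p; have [y <-] := quo_proj_surj q.
by rewrite -linearP !quo_lift_funE linearP.
Qed.
HB.instance Definition _ :=
  GRing.isLinear.Build k quo W *:%R quo_lift_fun quo_lift_linear.

Definition quo_lift : {linear quo -> W} := quo_lift_fun.

Lemma quo_liftE x : quo_lift (quo_proj x) = g x.
Proof. exact: quo_lift_funE. Qed.
End Lift.
End QuotientByRange.

Arguments quo_lift {k U V f W} g g_ran.
Arguments quo_liftE {k U V f W} g g_ran x.

Section DirectSum.
Variables (k : nzRingType) (I : finType) (V : I -> lmodType k).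

Definition dsum : Type := {dffun forall i : I, V i}.
HB.instance Definition _ := Choice.on dsum.

Definition dsum_mk (x : forall i, V i) : dsum := [ffun i => x i].

Lemma dsumP (x y : dsum) : (forall i, x i = y i) -> x = y.
Proof. by move=> e; apply/ffunP. Qed.

Lemma dsum_mkE x i : dsum_mk x i = x i.
Proof. exact: ffunE. Qed.

Let zero := dsum_mk (fun=> 0).
Let opp (x : dsum) := dsum_mk (fun i => - x i).
Let add (x y : dsum) := dsum_mk (fun i => x i + y i).
Let scale a (x : dsum) := dsum_mk (fun i => a *: x i).

Fact dsum_addA : associative add.
Proof. by move=> x y z; apply: dsumP => i; rewrite !dsum_mkE addrA. Qed.
Fact dsum_addC : commutative add.
Proof. by move=> x y; apply: dsumP => i; rewrite !dsum_mkE addrC. Qed.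
Fact dsum_add0 : left_id zero add.
Proof. by move=> x; apply: dsumP => i; rewrite !dsum_mkE add0r. Qed.
Fact dsum_addN : left_inverse zero opp add.
Proof. by move=> x; apply: dsumP => i; rewrite !dsum_mkE addNr. Qed.
HB.instance Definition _ := GRing.isZmodule.Build dsum
  dsum_addA dsum_addC dsum_add0 dsum_addN.

Fact dsum_scaleA a b x : scale a (scale b x) = scale (a * b) x.
Proof. by apply: dsumP => i; rewrite !dsum_mkE scalerA. Qed.
Fact dsum_scale1 : left_id 1 scale.
Proof. by move=> x; apply: dsumP => i; rewrite !dsum_mkE scale1r. Qed.
Fact dsum_scaleDr : right_distributive scale +%R.
Proof. by move=> a x y; apply: dsumP => i; rewrite !dsum_mkE scalerDr. Qed.
Fact dsum_scaleDl x : {morph scale^~ x : a b / a + b}.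
Proof. by move=> a b; apply: dsumP => i; rewrite !dsum_mkE scalerDl. Qed.
HB.instance Definition _ := GRing.Zmodule_isLmodule.Build k dsum
  dsum_scaleA dsum_scale1 dsum_scaleDr dsum_scaleDl.

Lemma dsum0E i : (0 : dsum) i = 0. Proof. exact: dsum_mkE. Qed.
Lemma dsumNE (x : dsum) i : (- x) i = - x i. Proof. exact: dsum_mkE. Qed.
Lemma dsumDE (x y : dsum) i : (x + y) i = x i + y i. Proof. exact: dsum_mkE. Qed.
Lemma dsumZE a (x : dsum) i : (a *: x) i = a *: x i. Proof. exact: dsum_mkE. Qed.

Definition dsum_inj i (x : V i) : dsum := dsum_mk (dfwith (fun j => 0 : V j) x).

Lemma dsum_inj_in i x : dsum_inj x i = x.
Proof. by rewrite dsum_mkE dfwith_in. Qed.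
Lemma dsum_inj_out i (x : V i) j : i != j -> dsum_inj x j = 0.
Proof. by move=> ij; rewrite dsum_mkE dfwith_out. Qed.

Lemma dsum_inj_linear i : linear (@dsum_inj i).
Proof.
move=> a x y; apply: dsumP => j; rewrite dsumDE dsumZE.
have [<-|ij] := eqVneq i j; first by rewrite !dsum_inj_in.
by rewrite !dsum_inj_out// scaler0 addr0.
Qed.
HB.instance Definition _ i :=
  GRing.isLinear.Build k (V i) dsum *:%R (@dsum_inj i) (@dsum_inj_linear i).
End DirectSum.

(* Only degrees m >= 0 are present, so the face C_0 -> C_{-1} = 0 is omitted:
   face m lists the maps C_{m+1} -> C_m. *)
Record paraPrecyclic (k : nzRingType) := ParaPrecyclic {
  pmod :> nat -> lmodType k;
  face : forall m, 'I_m.+2 -> {linear pmod m.+1 -> pmod m};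
  cyc : forall m, {linear pmod m -> pmod m};
  (* d_i d_(j+1) = d_j d_i for i <= j *)
  face_face : forall m (i j : 'I_m.+2) (x : pmod m.+2), (i <= j)%N ->
    face i (face (lift ord0 j) x) = face j (face (widen_ord (leqnSn _) i) x);
  cyc_bij : forall m, bijective (@cyc m);
  (* t d_i = d_(i+1) t *)
  cyc_face : forall m (i : 'I_m.+1) (x : pmod m.+1),
    cyc m (face (widen_ord (leqnSn _) i) x) = face (lift ord0 i) (cyc m.+1 x);
  face_max : forall m (x : pmod m.+1), face ord_max x = face ord0 (cyc m.+1 x)
}.

Arguments face {k C m} j : rename.
Arguments cyc {k C m} : rename.

Section Operators.
Variables (k : nzRingType) (C : paraPrecyclic k).

Definition cycT m (x : C m) : C m := iter m.+1 cyc x.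

Lemma cycT_linear m : linear (@cycT m).
Proof.
move=> a x y; rewrite /cycT; elim: m.+1 => //= n ->; exact: linearP.
Qed.
HB.instance Definition _ m :=
  GRing.isLinear.Build k (C m) (C m) *:%R (@cycT m) (@cycT_linear m).

Definition b m (x : C m.+1) : C m := \sum_(j < m.+2) (-1) ^+ j *: face j x.

Definition b' m (x : C m.+1) : C m :=
  \sum_(j < m.+1) (-1) ^+ j *: face (widen_ord (leqnSn _) j) x.

Definition tau m (x : C m) : C m := (-1) ^+ m *: cyc x.

Definition cycN m (x : C m) : C m := \sum_(j < m.+1) iter j (@tau m) x.

Definition sub1T m (x : C m) : C m := x - cycT x.
Definition sub1tau m (x : C m) : C m := x - tau x.

Lemma sign_scaleC (V : lmodType k) n a (x : V) :
  (-1) ^+ n *: (a *: x) = a *: ((-1) ^+ n *: x).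
Proof. by rewrite !scalerA commr_sign. Qed.

Lemma b_linear m : linear (@b m).
Proof.
move=> a x y; rewrite /b scaler_sumr -big_split; apply: eq_bigr => j _ /=.
by rewrite linearP scalerDr sign_scaleC.
Qed.
HB.instance Definition _ m :=
  GRing.isLinear.Build k (C m.+1) (C m) *:%R (@b m) (@b_linear m).

Lemma b'_linear m : linear (@b' m).
Proof.
move=> a x y; rewrite /b' scaler_sumr -big_split; apply: eq_bigr => j _ /=.
by rewrite linearP scalerDr sign_scaleC.
Qed.
HB.instance Definition _ m :=
  GRing.isLinear.Build k (C m.+1) (C m) *:%R (@b' m) (@b'_linear m).

Lemma tau_linear m : linear (@tau m).
Proof. by move=> a x y; rewrite /tau linearP scalerDr sign_scaleC. Qed.
HB.instance Definition _ m :=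
  GRing.isLinear.Build k (C m) (C m) *:%R (@tau m) (@tau_linear m).

Lemma iter_linear (V : lmodType k) (f : {linear V -> V}) n : linear (iter n f).
Proof. by move=> a x y; elim: n => //= n ->; rewrite linearP. Qed.

Lemma cycN_linear m : linear (@cycN m).
Proof.
move=> a x y; rewrite /cycN scaler_sumr -big_split; apply: eq_bigr => j _ /=.
exact: (iter_linear (@tau m)).
Qed.
HB.instance Definition _ m :=
  GRing.isLinear.Build k (C m) (C m) *:%R (@cycN m) (@cycN_linear m).

Lemma sub1T_linear m : linear (@sub1T m).
Proof. by move=> a x y; rewrite /sub1T linearP scalerBr opprD addrACA. Qed.
HB.instance Definition _ m :=
  GRing.isLinear.Build k (C m) (C m) *:%R (@sub1T m) (@sub1T_linear m).

Lemma sub1tau_linear m : linear (@sub1tau m).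
Proof. by move=> a x y; rewrite /sub1tau linearP scalerBr opprD addrACA. Qed.
HB.instance Definition _ m :=
  GRing.isLinear.Build k (C m) (C m) *:%R (@sub1tau m) (@sub1tau_linear m).

End Operators.

Section Identities.
Variables (k : nzRingType) (C : paraPrecyclic k).

Lemma cyc_inj m : injective (@cyc k C m).
Proof. exact/bij_inj/cyc_bij. Qed.

Lemma cycT_cyc m (x : C m) : cycT (cyc x) = cyc (cycT x).
Proof. by rewrite /cycT -iterSr. Qed.

Lemma tau_iter m n (x : C m) : iter n (@tau k C m) x = (-1) ^+ (m * n) *: iter n cyc x.
Proof.
elim: n => [|n IHn] /=; first by rewrite muln0 scale1r.
by rewrite IHn /tau linearZ_LR /= scalerA -exprD mulnS.
Qed.

Lemma tau_cycT m (x : C m) : iter m.+1 (@tau k C m) x = cycT x.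
Proof. by rewrite tau_iter -signr_odd oddM /= andbN scale1r. Qed.

(* t^n d_i = d_(i+n) t^n *)
Lemma iter_cyc_face m n (i j : 'I_m.+2) (x : C m.+1) : j = (i + n)%N :> nat ->
  iter n cyc (face i x) = face j (iter n cyc x).
Proof.
elim: n j => [|n IHn] j; first by rewrite addn0 => /ord_inj ->.
rewrite addnS => ji.
have lt_in : (i + n < m.+1)%N by rewrite -ltnS -ji ltn_ord.
rewrite iterS (IHn (widen_ord (leqnSn _) (Ordinal lt_in)))//.
by rewrite cyc_face iterS; congr (face _ _); apply: val_inj; rewrite /= /bump ji.
Qed.

Lemma iter_cyc_face_all m (i : 'I_m.+2) (x : C m.+1) :
  iter m.+1 cyc (face i x) = face i (iter m.+2 cyc x).
Proof.
have le_im : (i <= m.+1)%N by rewrite -ltnS.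
rewrite -{1}(subnKC le_im) iterD (@iter_cyc_face _ _ i ord_max); last first.
  by rewrite /= subnKC.
rewrite face_max (@iter_cyc_face _ _ ord0 i)//; congr (face _ _).
by rewrite -iterS -iterD addnS subnKC.
Qed.

Lemma cycT_face m (i : 'I_m.+2) (x : C m.+1) : cycT (face i x) = face i (cycT x).
Proof. exact: iter_cyc_face_all. Qed.

Lemma sub1T_face m (i : 'I_m.+2) (x : C m.+1) : face i (sub1T x) = sub1T (face i x).
Proof. by rewrite /sub1T linearB /= cycT_face. Qed.

Lemma sub1T_cyc m (x : C m) : cyc (sub1T x) = sub1T (cyc x).
Proof. by rewrite /sub1T linearB /= cycT_cyc. Qed.

Lemma sub1tau_cycN m (x : C m) : sub1tau (cycN x) = sub1T x.
Proof.
rewrite /sub1tau /cycN linear_sum /= big_ord_recl big_ord_recr /=.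
rewrite [X in _ - X]addrC opprD addrACA -sumrB big1; last first.
  by move=> i _; rewrite /= subrr.
by rewrite /sub1T -tau_cycT addr0.
Qed.

Lemma cycN_sub1tau m (x : C m) : cycN (sub1tau x) = sub1T x.
Proof.
rewrite -sub1tau_cycN /sub1tau linearB; congr (_ - _).
rewrite /cycN linear_sum; apply: eq_bigr => i _.
by rewrite -iterSr.
Qed.

Lemma tau_face m (i : 'I_m.+1) (x : C m.+1) :
  tau (face (widen_ord (leqnSn _) i) x) = - face (lift ord0 i) (tau x).
Proof.
by rewrite /tau cyc_face linearZ_LR exprS mulN1r scaleNr opprK.
Qed.

Lemma tau_face_max m (x : C m.+1) :
  face ord0 (tau x) = (-1) ^+ m.+1 *: face ord_max x.
Proof. by rewrite /tau linearZ_LR /= face_max. Qed.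

Lemma b_sub1tau m (x : C m.+1) : b (sub1tau x) = sub1tau (b' x).
Proof.
rewrite /sub1tau linearB /=.
have -> : b x = b' x + (-1) ^+ m.+1 *: face ord_max x.
  by rewrite /b big_ord_recr /=.
have -> : b (tau x) = (-1) ^+ m.+1 *: face ord_max x + tau (b' x).
  rewrite {1}/b big_ord_recl expr0 scale1r tau_face_max; congr (_ + _).
  rewrite /b' linear_sum; apply: eq_bigr => j _ /=.
  rewrite [RHS]linearZ_LR /= tau_face exprS mulN1r scaleNr scalerN.
  by [].
by rewrite opprD addrA addrK.
Qed.

Lemma simplicial_sum0 (V : lmodType k) (F : nat -> nat -> V) n :
  (forall i j, (i <= j < n)%N -> F i j.+1 = F j i) ->
  \sum_(j < n.+1) \sum_(i < n) (-1) ^+ (i + j) *: F i j = 0.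
Proof.
elim: n => [|n IHn] FE; first by rewrite big1 // => j _; rewrite big_ord0.
rewrite big_ord_recr /=.
under eq_bigr do rewrite big_ord_recr /=.
rewrite big_split /= IHn ?add0r; last first.
  by move=> i j /andP[ij jn]; rewrite FE// ij ltnS ltnW.
rewrite big_ord_recr [X in _ + X]big_ord_recr /= addnS exprS mulN1r.
rewrite (FE n n) ?leqnn// scaleNr [X in _ + X]addrC addrA addrK.
rewrite -big_split big1// => i _ /=; rewrite FE ?ltnSn ?andbT 1?ltnW//.
by rewrite addnS exprS mulN1r addnC -scalerDl subrr scale0r.
Qed.

Let F m (x : C m.+2) i j := face (inord i) (face (inord j) x).
Let FE m (x : C m.+2) i j : (i <= j < m.+2)%N -> F x i j.+1 = F x j i.
Proof.
move=> /andP[ij jm].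
have -> : F x i j.+1 =
    face (Ordinal (leq_ltn_trans ij jm)) (face (lift ord0 (Ordinal jm)) x).
  congr (face _ (face _ _)); apply: val_inj; rewrite /= inordK//.
  exact: leq_ltn_trans ij jm.
rewrite face_face//=; congr (face _ (face _ _)); apply: val_inj; rewrite /= inordK//.
by rewrite ltnW// ltnS (leq_ltn_trans ij jm).
Qed.

Lemma b_b m (x : C m.+2) : b (b x) = 0.
Proof.
rewrite -(simplicial_sum0 (@FE m x)) /b.
rewrite [RHS]exchange_big /=; apply: eq_bigr => i _.
rewrite linear_sum scaler_sumr.
apply: eq_bigr => j _; rewrite linearZ_LR scalerA exprD.
by rewrite /F !inord_val.
Qed.

Lemma b'_b' m (x : C m.+2) : b' (b' x) = 0.
Proof.
have := @simplicial_sum0 _ (F x) m.+1; rewrite exchange_big /= => <-; last first.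
  by move=> i j /andP[ij jm]; rewrite FE// ij ltnW.
rewrite /b'; apply: eq_bigr => i _.
rewrite linear_sum scaler_sumr.
apply: eq_bigr => j _; rewrite linearZ_LR scalerA exprD.
congr (_ *: face _ (face _ _)); apply: val_inj; rewrite /= inordK//.
  by rewrite ltnW// ltnS.
by rewrite ltnW// ltnS.
Qed.

Lemma tau_iter_face m n (x : C m.+1) (j : 'I_m.+2) : n = j :> nat ->
  iter n (@tau k C m) (face ord0 x) = (-1) ^+ j *: face j (iter n (@tau k C m.+1) x).
Proof.
move=> nj; rewrite !tau_iter (@iter_cyc_face _ n ord0 j)//.
rewrite linearZ_LR /= scalerA -exprD -nj mulSn addnA addnn.
by rewrite [in RHS]exprD -[_ ^+ n.*2]signr_odd odd_double mul1r.
Qed.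

Lemma iter_tau_cycN m n (x : C m) : cycT x = x ->
  iter n (@tau k C m) (cycN x) = cycN x.
Proof.
move=> Tx; elim: n => //= n ->.
by apply/eqP; rewrite eq_sym -subr_eq0 -/(sub1tau _) sub1tau_cycN /sub1T Tx subrr.
Qed.

Lemma cycT_tau m (x : C m) : cycT (tau x) = tau (cycT x).
Proof. by rewrite -!tau_cycT -iterSr. Qed.

Lemma cycN_iter_tau m n (x : C m) : cycT x = x ->
  cycN (iter n (@tau k C m) x) = cycN x.
Proof.
move=> Tx; have TT j : cycT (iter j (@tau k C m) x) = iter j (@tau k C m) x.
  by elim: j => //= j {2}<-; rewrite cycT_tau.
elim: n => //= n <-; apply/eqP; rewrite eq_sym -subr_eq0 -linearB /=.
by rewrite -/(sub1tau _) cycN_sub1tau /sub1T TT subrr.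
Qed.

Lemma b'_cycN m (x : C m.+1) : cycT x = x ->
  b' (cycN x) = cycN (face ord0 (cycN x)).
Proof.
move=> Tx; rewrite /b' [RHS]/cycN; apply: eq_bigr => j _.
by rewrite (@tau_iter_face _ _ _ (widen_ord (leqnSn _) j))// iter_tau_cycN.
Qed.

Lemma cycN_b m (x : C m.+1) : cycT x = x ->
  cycN (b x) = cycN (face ord0 (cycN x)).
Proof.
move=> Tx; rewrite /b raddf_sum.
have TT : forall m (i : 'I_m.+2) (z : C m.+1), cycT z = z ->
    cycT (face i z) = face i z.
  by move=> ? ? ? e; rewrite cycT_face e.
have Tt j : cycT (iter j (@tau k C m.+1) x) = iter j (@tau k C m.+1) x.
  by elim: j => //= j {2}<-; rewrite cycT_tau.
transitivity (\sum_(j < m.+2) cycN (face ord0 (iter (m.+2 - j) (@tau k C m.+1) x))).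
  apply: eq_bigr => j _.
  rewrite -[RHS](cycN_iter_tau j) ?TT//.
  rewrite (@tau_iter_face _ _ _ j)// -iterD subnKC 1?ltnW//.
  by rewrite tau_cycT Tx.
rewrite -!raddf_sum /=; congr (cycN (face _ _)).
rewrite -(iter_tau_cycN 1 Tx) /= /cycN raddf_sum /= (reindex_inj rev_ord_inj) /=.
by apply: eq_bigr => j _; rewrite -iterS subKn.
Qed.

Lemma cycN_b_b'_cycN m (x : C m.+1) : cycT x = x -> cycN (b x) = b' (cycN x).
Proof. by move=> Tx; rewrite cycN_b// b'_cycN. Qed.
End Identities.

Record precyclic (k : nzRingType) := Precyclic {
  para_of :> paraPrecyclic k;
  cycT1 : forall m (x : para_of m), cycT x = x
}.

Section QuotientCT.
Variables (k : nzRingType) (C : paraPrecyclic k).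

Definition CT_mod m : lmodType k := quo (@sub1T k C m).
Definition projT m : {linear C m -> CT_mod m} := quo_proj (@sub1T k C m).

Lemma CT_face_ran m (j : 'I_m.+2) (y : C m.+1) :
  (@projT m \o face j) (sub1T y) = 0.
Proof. by apply/quo_proj_eq0; exists (face j y); rewrite sub1T_face. Qed.
Lemma CT_cyc_ran m (y : C m) : (@projT m \o cyc) (sub1T y) = 0.
Proof. by apply/quo_proj_eq0; exists (cyc y); rewrite sub1T_cyc. Qed.

Definition CT_face m (j : 'I_m.+2) : {linear CT_mod m.+1 -> CT_mod m} :=
  quo_lift (@projT m \o face j) (@CT_face_ran m j).
Definition CT_cyc m : {linear CT_mod m -> CT_mod m} :=
  quo_lift (@projT m \o cyc) (@CT_cyc_ran m).

Lemma CT_faceE m (j : 'I_m.+2) (x : C m.+1) : CT_face j (projT _ x) = projT _ (face j x).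
Proof. by rewrite /CT_face quo_liftE. Qed.
Lemma CT_cycE m (x : C m) : CT_cyc m (projT _ x) = projT _ (cyc x).
Proof. by rewrite /CT_cyc quo_liftE. Qed.
Lemma projT_surj m (q : CT_mod m) : exists x, projT m x = q.
Proof. exact: quo_proj_surj. Qed.

Lemma CT_face_face m (i j : 'I_m.+2) (x : CT_mod m.+2) : (i <= j)%N ->
  CT_face i (CT_face (lift ord0 j) x) = CT_face j (CT_face (widen_ord (leqnSn _) i) x).
Proof. by case: (projT_surj x) => y <- ij; rewrite !CT_faceE face_face. Qed.

Lemma CT_cycT m (x : CT_mod m) : iter m.+1 (CT_cyc m) x = x.
Proof.
have [y <-] := projT_surj x.
transitivity (projT m (cycT y)).
  by rewrite /cycT; elim: m.+1 => // n; rewrite !iterS => ->; rewrite CT_cycE.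
apply/esym/eqP; rewrite -subr_eq0 -linearB /=; apply/eqP/quo_proj_eq0.
by exists y.
Qed.

Lemma CT_cyc_bij m : bijective (CT_cyc m).
Proof. by exists (iter m (CT_cyc m)) => x; rewrite -?iterSr -?iterS CT_cycT. Qed.

Lemma CT_cyc_face m (i : 'I_m.+1) (x : CT_mod m.+1) :
  CT_cyc m (CT_face (widen_ord (leqnSn _) i) x) = CT_face (lift ord0 i) (CT_cyc m.+1 x).
Proof.
by case: (projT_surj x) => y <-; rewrite !(CT_faceE, CT_cycE) cyc_face.
Qed.

Lemma CT_face_max m (x : CT_mod m.+1) :
  CT_face ord_max x = CT_face ord0 (CT_cyc m.+1 x).
Proof. by case: (projT_surj x) => y <-; rewrite !(CT_faceE, CT_cycE) face_max. Qed.

Definition CT : precyclic k :=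
  Precyclic (para_of := ParaPrecyclic CT_face_face CT_cyc_bij CT_cyc_face CT_face_max)
    CT_cycT.
End QuotientCT.

Arguments projT {k C m}.

(* Nonnegatively graded chain complexes; in degree 0 the differential is 0. *)
Record chainComplex (k : nzRingType) := ChainComplex {
  cmod :> nat -> lmodType k;
  dif : forall m, {linear cmod m.+1 -> cmod m};
  dif_dif : forall m (x : cmod m.+2), dif m (dif m.+1 x) = 0
}.
Arguments dif {k c m} : rename.

Section ChainMaps.
Variables (k : nzRingType).

Definition is_chain_map (X Y : chainComplex k) (f : forall m, {linear X m -> Y m}) :=
  forall m (x : X m.+1), dif (f m.+1 x) = f m (dif x).

(* d h + h d; the second term is absent in degree 0. *)
Definition dh_hd (X : chainComplex k) (h : forall m, {linear X m -> X m.+1}) m :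
    X m -> X m :=
  match m with
  | 0 => fun x => dif (h 0 x)
  | n.+1 => fun x => dif (h n.+1 x) + h n (dif x)
  end.

Record deformation_retract (X Y : chainComplex k)
    (p : forall m, {linear X m -> Y m}) (s : forall m, {linear Y m -> X m})
    (h : forall m, {linear X m -> X m.+1}) : Prop := DeformationRetract {
  retract_proj_chain : is_chain_map p;
  retract_sect_chain : is_chain_map s;
  retract_projK : forall m (y : Y m), p m (s m y) = y;
  retract_homotopy : forall m (x : X m), s m (p m x) = x + dh_hd h x
}.
End ChainMaps.

Section CyclicBicomplex.
Variables (k : nzRingType) (C : paraPrecyclic k).

(* An element of degree m is \sum_(q <= m) x_q u^(m - q) with x_q in C_q; it is
   stored as the family (x_q). *)
Definition cnn m : lmodType k := dsum (fun q : 'I_m.+1 => C q).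

Lemma cnnP m (x y : cnn m) : (forall q, x q = y q) -> x = y.
Proof. exact: dsumP. Qed.
Lemma cnn0E m q : (0 : cnn m) q = 0. Proof. exact: dsum0E. Qed.
Lemma cnnNE m (x : cnn m) q : (- x) q = - x q. Proof. exact: dsumNE. Qed.
Lemma cnnDE m (x y : cnn m) q : (x + y) q = x q + y q.
Proof. exact: dsumDE. Qed.
Lemma cnnZE m a (x : cnn m) q : (a *: x) q = a *: x q.
Proof. exact: dsumZE. Qed.

(* The element x u^(m - q). *)
Definition upow m (q : 'I_m.+1) (x : C q) : cnn m :=
  dsum_inj (V := fun q : 'I_m.+1 => C q) x.

Definition partial m (x : cnn m.+1) : cnn m :=
  dsum_mk (V := fun q : 'I_m.+1 => C q) (fun q =>
    let xq : C q := x (widen_ord (leqnSn _) q) in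
    if odd (m.+1 - q) then sub1tau xq else cycN xq).

Definition delta m (x : cnn m.+1) : cnn m :=
  dsum_mk (V := fun q : 'I_m.+1 => C q) (fun q =>
    let xq1 : C q.+1 := x (lift ord0 q) in
    if odd (m - q) then - b' xq1 else b xq1).

Lemma partialE m (x : cnn m.+1) (q : 'I_m.+1) :
  partial x q = (let xq : C q := x (widen_ord (leqnSn _) q) in
                 if odd (m.+1 - q) then sub1tau xq else cycN xq).
Proof. exact: dsum_mkE. Qed.

Lemma deltaE m (x : cnn m.+1) (q : 'I_m.+1) :
  delta x q = (let xq1 : C q.+1 := x (lift ord0 q) in
               if odd (m - q) then - b' xq1 else b xq1).
Proof. exact: dsum_mkE. Qed.

Lemma partial_upow m (q : 'I_m.+1) (x : C q) :
  partial (upow (q := widen_ord (leqnSn _) q) x)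
  = upow (if odd (m.+1 - q) then sub1tau x else cycN x).
Proof.
apply: dsumP => r; rewrite dsum_mkE /=; have [<-|qr] := eqVneq q r.
  by rewrite /upow !dsum_inj_in.
by rewrite /upow !dsum_inj_out// !linear0; case: ifP.
Qed.

Lemma partial_upow0 m (x : C m.+1) : partial (upow (q := ord_max) x) = 0.
Proof.
apply: dsumP => r; rewrite dsum_mkE dsum0E /= /upow dsum_inj_out.
  by rewrite !linear0; case: ifP.
by rewrite -val_eqE /= neq_ltn ltn_ord orbT.
Qed.

Lemma delta_upow m (q : 'I_m.+1) (x : C q.+1) :
  delta (upow (q := lift ord0 q) x) = upow (if odd (m - q) then - b' x else b x).
Proof.
apply: dsumP => r; rewrite dsum_mkE /=; have [<-|qr] := eqVneq q r.
  by rewrite /upow !dsum_inj_in.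
by rewrite /upow !dsum_inj_out// !linear0; case: ifP.
Qed.

Lemma delta_upow_last m (x : C 0) : delta (upow (m := m.+1) (q := ord0) x) = 0.
Proof.
apply: dsumP => r; rewrite dsum_mkE dsum0E /= /upow dsum_inj_out//.
by rewrite !linear0; case: ifP.
Qed.

Lemma partial_linear m : linear (@partial m).
Proof.
move=> a x y; apply: cnnP => q; rewrite cnnDE cnnZE !partialE cnnDE cnnZE /=.
by case: ifP => _; rewrite linearP.
Qed.
HB.instance Definition _ m := GRing.isLinear.Build k (cnn m.+1) (cnn m) *:%R
  (@partial m) (@partial_linear m).

Lemma delta_linear m : linear (@delta m).
Proof.
move=> a x y; apply: cnnP => q; rewrite cnnDE cnnZE !deltaE cnnDE cnnZE /=.
by case: ifP => _; rewrite linearP // opprD scalerN.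
Qed.
HB.instance Definition _ m := GRing.isLinear.Build k (cnn m.+1) (cnn m) *:%R
  (@delta m) (@delta_linear m).

Definition dtot m (x : cnn m.+1) : cnn m := partial x + delta x.
Lemma dtot_linear m : linear (@dtot m).
Proof. by move=> a x y; rewrite /dtot !linearP scalerDr addrACA. Qed.
HB.instance Definition _ m := GRing.isLinear.Build k (cnn m.+1) (cnn m) *:%R
  (@dtot m) (@dtot_linear m).

Definition pi0nn m (x : cnn m) : C m := x ord_max.
Lemma pi0nn_linear m : linear (@pi0nn m).
Proof. by move=> a x y; rewrite /pi0nn cnnDE cnnZE. Qed.
HB.instance Definition _ m := GRing.isLinear.Build k (cnn m) (C m) *:%R
  (@pi0nn m) (@pi0nn_linear m).
End CyclicBicomplex.

Arguments upow {k C m q} x.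

Section Complexes.
Variable k : nzRingType.

Lemma cnn_irr (C : paraPrecyclic k) m (x : cnn C m) n (h h' : (n < m.+1)%N) :
  (x (Ordinal h) : C n) = x (Ordinal h').
Proof. by rewrite (bool_irrelevance h h'). Qed.

Lemma dtot_dtot (C : precyclic k) m (x : cnn C m.+2) : dtot (dtot x) = 0.
Proof.
apply: dsumP => -[q hq].
rewrite /dtot cnn0E cnnDE partialE deltaE /= !cnnDE !partialE !deltaE /=.
have le_qm : (q <= m)%N by [].
rewrite !subSS !subSn// 1?leqW//= negbK.
have e : (x (widen_ord (leqnSn _) (lift ord0 (Ordinal hq))) : C q.+1) =
  x (lift ord0 (widen_ord (leqnSn _) (Ordinal hq))) by apply: cnn_irr.
rewrite e; case: (odd (m - q)) => /=.
  suff main (x0 : C q) (x1 : C q.+1) (x2 : C q.+2) :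
      cycN (sub1tau x0 + b x1) + - b' (cycN x1 + - b' x2) = 0 by exact (main _ _ _).
  rewrite (linearD (@cycN k C q)) (linearB (@b' k C q)) /=.
  rewrite cycN_sub1tau b'_b' subr0 cycN_b_b'_cycN ?cycT1//.
  by rewrite addrK /sub1T cycT1 subrr.
suff main (x0 : C q) (x1 : C q.+1) (x2 : C q.+2) :
    sub1tau (cycN x0 + - b' x1) + b (sub1tau x1 + b x2) = 0 by exact (main _ _ _).
rewrite (linearB (@sub1tau k C q)) (linearD (@b k C q)) /= sub1tau_cycN b_b addr0 b_sub1tau.
by rewrite /sub1T cycT1 subrr sub0r addNr.
Qed.

Definition lam (C : paraPrecyclic k) m : lmodType k := quo (@sub1tau k C m).
Definition pilam (C : paraPrecyclic k) m : {linear C m -> lam C m} :=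
  quo_proj (@sub1tau k C m).

Lemma lam_b_ran (C : paraPrecyclic k) m (y : C m.+1) :
  (@pilam C m \o @b k C m) (sub1tau y) = 0.
Proof. by apply/quo_proj_eq0; exists (b' y); rewrite /= b_sub1tau. Qed.

Definition lam_b (C : paraPrecyclic k) m : {linear lam C m.+1 -> lam C m} :=
  quo_lift (@pilam C m \o @b k C m) (@lam_b_ran C m).

Lemma lam_bE (C : paraPrecyclic k) m (x : C m.+1) :
  lam_b C m (pilam C _ x) = pilam C _ (b x).
Proof. by rewrite /lam_b quo_liftE. Qed.

Lemma lam_b_b (C : paraPrecyclic k) m (x : lam C m.+2) : lam_b C m (lam_b C m.+1 x) = 0.
Proof.
by have [y <-] := quo_proj_surj x; rewrite !lam_bE b_b linear0.
Qed.
Definition lam_complex (C : paraPrecyclic k) : chainComplex k :=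
  ChainComplex (@lam_b_b C).
End Complexes.

Definition cnn_complex (k : nzRingType) (C : precyclic k) : chainComplex k :=
  ChainComplex (cmod := cnn C) (dif := @dtot k C) (@dtot_dtot k C).

Section Homotopy.
(* The inclusion of Q in k; its image is automatically central. *)
Variables (k : nzRingType) (iota : {rmorphism rat -> k}) (C : paraPrecyclic k).

Lemma iota_inv_comm n (a : k) : iota n.+1%:R^-1 * a = a * iota n.+1%:R^-1.
Proof.
set i := iota _; have iK : n.+1%:R * i = 1.
  by rewrite -(rmorph_nat iota) -rmorphM mulfV ?rmorph1// Num.Theory.pnatr_eq0.
have Ki : i * n.+1%:R = 1 by rewrite commr_nat.
have -> : i * a = i * a * (n.+1%:R * i) by rewrite iK mulr1.
by rewrite mulrA -(mulrA i) commr_nat mulrA Ki mul1r.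
Qed.

Definition hat m (x : C m) : C m := iota m.+1%:R^-1 *: x.
Definition hatN m (x : C m) : C m := cycN (hat x).
Definition hatD m (x : C m) : C m :=
  \sum_(j < m.+1) iter j (@tau k C m) (hat x) *+ (m - j).

Lemma hat_linear m : linear (@hat m).
Proof.
by move=> a x y; rewrite /hat scalerDr scalerA iota_inv_comm -scalerA.
Qed.
HB.instance Definition _ m :=
  GRing.isLinear.Build k (C m) (C m) *:%R (@hat m) (@hat_linear m).

Lemma hatN_linear m : linear (@hatN m).
Proof. by move=> a x y; rewrite /hatN !linearP. Qed.
HB.instance Definition _ m :=
  GRing.isLinear.Build k (C m) (C m) *:%R (@hatN m) (@hatN_linear m).

Lemma hatD_linear m : linear (@hatD m).
Proof.
move=> a x y; rewrite /hatD scaler_sumr -big_split; apply: eq_bigr => j _ /=.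
rewrite linearP (iter_linear (@tau k C m)) mulrnDl.
by rewrite -!scaler_nat !scalerA commr_nat.
Qed.
HB.instance Definition _ m :=
  GRing.isLinear.Build k (C m) (C m) *:%R (@hatD m) (@hatD_linear m).

(* phi does not change the coefficient index q; it raises the power of u from
   m - q to m + 1 - q, and produces no term with q = m + 1. *)
Definition phi m (x : cnn C m) : cnn C m.+1 :=
  dsum_mk (V := fun q : 'I_m.+2 => C q) (fun q =>
    if @idP (q < m.+1)%N is ReflectT q_lt then
      let xq : C q := x (Ordinal q_lt) in
      if odd (m - q) then - hat xq else - hatD xq
    else 0).

Lemma phiE m (x : cnn C m) (q : 'I_m.+2) : phi x q =
  if @idP (q < m.+1)%N is ReflectT q_lt then
    let xq : C q := x (Ordinal q_lt) in
    if odd (m - q) then - hat xq else - hatD xq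
  else 0.
Proof. exact: dsum_mkE. Qed.

Lemma phi_widen m (x : cnn C m) (q : 'I_m.+1) :
  phi x (widen_ord (leqnSn _) q) =
  (if odd (m - q) then - hat (x q) else - hatD (x q) : C q).
Proof.
rewrite phiE /=; case: {-}_ / idP => [h|]; last by rewrite ltn_ord.
by case: q h => q hq h; rewrite (bool_irrelevance h hq).
Qed.

Lemma phi_max m (x : cnn C m) : phi x ord_max = 0.
Proof. by rewrite phiE /=; case: {-}_ / idP => // h; have := h; rewrite ltnn. Qed.

Lemma cnn_case m (q : 'I_m.+2) :
  {r : 'I_m.+1 | q = widen_ord (leqnSn _) r} + {q = ord_max}.
Proof.
have [lt_qm|ge_qm] := ltnP q m.+1.
  by left; exists (Ordinal lt_qm); apply: val_inj.
by right; apply: val_inj; apply/eqP; rewrite eqn_leq -ltnS ltn_ord.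
Qed.

Lemma phi_upow m (q : 'I_m.+1) (x : C q) :
  phi (upow x) = upow (q := widen_ord (leqnSn _) q)
                      (if odd (m - q) then - hat x else - hatD x).
Proof.
apply: cnnP => r; case: (cnn_case r) => [[s ->]|->].
  rewrite phi_widen; have [<-|qs] := eqVneq q s.
    by rewrite /upow !dsum_inj_in.
  by rewrite /upow !dsum_inj_out// !linear0; case: ifP.
by rewrite phi_max /upow dsum_inj_out// -val_eqE /= neq_ltn ltn_ord.
Qed.

Lemma phi_linear m : linear (@phi m).
Proof.
move=> a x y; apply: cnnP => r; rewrite cnnDE cnnZE.
case: (cnn_case r) => [[q ->]|->]; last by rewrite !phi_max scaler0 addr0.
rewrite !phi_widen cnnDE cnnZE /=.
by case: ifP => _; rewrite linearP opprD scalerN.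
Qed.
HB.instance Definition _ m := GRing.isLinear.Build k (cnn C m) (cnn C m.+1) *:%R
  (@phi m) (@phi_linear m).

Definition nu m (x : C m) : cnn C m := upow (q := ord_max) (hatN x).

Lemma nu_linear m : linear (@nu m).
Proof.
move=> a x y; rewrite /nu linearP.
exact: (@dsum_inj_linear k _ (fun q : 'I_m.+1 => C q) ord_max).
Qed.
HB.instance Definition _ m := GRing.isLinear.Build k (C m) (cnn C m) *:%R
  (@nu m) (@nu_linear m).

(* phi \o delta; delta = 0 in degree 0. *)
Definition phidelta m : cnn C m -> cnn C m :=
  match m with
  | 0 => fun=> 0
  | n.+1 => fun x => phi (delta x)
  end.

Lemma phidelta_linear m : linear (@phidelta m).
Proof.
case: m => [|m] a x y /=; first by rewrite scaler0 addr0.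
by rewrite !linearP.
Qed.
HB.instance Definition _ m := GRing.isLinear.Build k (cnn C m) (cnn C m) *:%R
  (@phidelta m) (@phidelta_linear m).

Lemma iter_phidelta_coef m j (x : cnn C m) (q : 'I_m.+1) :
  (m < q + j)%N -> iter j (@phidelta m) x q = 0.
Proof.
elim: j q => [|j IHj] q; first by rewrite addn0 ltnNge -ltnS ltn_ord.
rewrite iterS; case: m x q IHj => [|m] x q IHj lt_m /=; first exact: cnn0E.
case: (cnn_case q) lt_m => [[r ->]|->]; last by rewrite phi_max.
move=> /= lt_m; rewrite phi_widen deltaE /= IHj; last first.
  by rewrite /= /bump leq0n add1n addSnnS.
by rewrite !linear0; case: ifP; case: ifP => *; rewrite !linear0.
Qed.

(* The terms omitted from the sum defining geom vanish. *)
Lemma iter_phidelta0 m j (x : cnn C m) : (m < j)%N -> iter j (@phidelta m) x = 0.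
Proof.
move=> lt_mj; apply: cnnP => q; rewrite cnn0E iter_phidelta_coef//.
exact: leq_trans lt_mj (leq_addl _ _).
Qed.

(* \sum_(j >= 0) (phi \o delta)^j *)
Definition geom m (x : cnn C m) : cnn C m := \sum_(j < m.+1) iter j (@phidelta m) x.

Lemma geom_linear m : linear (@geom m).
Proof.
move=> a x y; rewrite /geom scaler_sumr -big_split; apply: eq_bigr => j _ /=.
exact: (iter_linear (@phidelta m)).
Qed.
HB.instance Definition _ m := GRing.isLinear.Build k (cnn C m) (cnn C m) *:%R
  (@geom m) (@geom_linear m).

Definition phinn m : {linear cnn C m -> cnn C m.+1} := @geom m.+1 \o @phi m.
Definition nu0nn m : {linear C m -> cnn C m} := @geom m \o @nu m.
Definition pinn m : {linear cnn C m -> lam C m} := pilam C m \o @pi0nn k C m.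
End Homotopy.

Section Descent.
Variables (k : nzRingType) (iota : {rmorphism rat -> k}) (C : paraPrecyclic k).

Definition piTnn m (x : cnn C m) : cnn (CT C) m :=
  dsum_mk (V := fun q : 'I_m.+1 => CT C q) (fun q => projT (x q)).

Lemma piTnnE m (x : cnn C m) q : piTnn x q = projT (x q).
Proof. exact: dsum_mkE. Qed.

Lemma piTnn_linear m : linear (@piTnn m).
Proof. by move=> a x y; apply: cnnP => q; rewrite cnnDE cnnZE !piTnnE cnnDE cnnZE linearP. Qed.
HB.instance Definition _ m := GRing.isLinear.Build k (cnn C m) (cnn (CT C) m) *:%R
  (@piTnn m) (@piTnn_linear m).

Lemma projT_tau m (x : C m) : projT (tau x) = tau (projT x : CT C m).
Proof. by rewrite /tau linearZ_LR /= -CT_cycE. Qed.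

Lemma projT_iter_tau m n (x : C m) :
  projT (iter n (@tau k C m) x) = iter n (@tau k (CT C) m) (projT x).
Proof. by elim: n => //= n <-; rewrite projT_tau. Qed.

Lemma projT_cycN m (x : C m) : projT (cycN x) = cycN (projT x : CT C m).
Proof. by rewrite /cycN linear_sum; apply: eq_bigr => j _; rewrite projT_iter_tau. Qed.

Lemma projT_hat m (x : C m) : projT (hat iota x) = hat iota (projT x : CT C m).
Proof. by rewrite /hat linearZ. Qed.

Lemma projT_hatN m (x : C m) : projT (hatN iota x) = hatN iota (projT x : CT C m).
Proof. by rewrite /hatN projT_cycN projT_hat. Qed.

Lemma projT_hatD m (x : C m) : projT (hatD iota x) = hatD iota (projT x : CT C m).
Proof.
rewrite /hatD linear_sum; apply: eq_bigr => j _.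
by rewrite linearMn /= projT_iter_tau projT_hat.
Qed.

Lemma projT_b m (x : C m.+1) : projT (b x) = b (projT x : CT C m.+1).
Proof.
by rewrite /b linear_sum; apply: eq_bigr => j _; rewrite linearZ_LR /= -CT_faceE.
Qed.

Lemma projT_b' m (x : C m.+1) : projT (b' x) = b' (projT x : CT C m.+1).
Proof.
by rewrite /b' linear_sum; apply: eq_bigr => j _; rewrite linearZ_LR /= -CT_faceE.
Qed.

Lemma piTnn_delta m (x : cnn C m.+1) : piTnn (delta x) = delta (piTnn x).
Proof.
apply: cnnP => q; rewrite piTnnE !deltaE /= piTnnE.
by case: ifP => _; rewrite ?linearN ?projT_b// projT_b'.
Qed.

Lemma piTnn_phi m (x : cnn C m) : piTnn (phi iota x) = phi iota (piTnn x).
Proof.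
apply: cnnP => r; rewrite piTnnE.
case: (cnn_case r) => [[q ->]|->]; last by rewrite !phi_max linear0.
rewrite !phi_widen piTnnE.
by case: ifP => _; rewrite linearN /= ?projT_hat ?projT_hatD.
Qed.

Lemma piTnn_phidelta m (x : cnn C m) :
  piTnn (phidelta iota x) = phidelta iota (piTnn x).
Proof.
by case: m x => [|m] x /=; rewrite ?linear0// piTnn_phi piTnn_delta.
Qed.

Lemma piTnn_geom m (x : cnn C m) : piTnn (geom iota x) = geom iota (piTnn x).
Proof.
rewrite /geom linear_sum; apply: eq_bigr => j _ /=.
by elim: {j}(j : nat) => //= j <-; rewrite piTnn_phidelta.
Qed.

Lemma piTnn_nu m (x : C m) : piTnn (nu iota x) = nu iota (projT x : CT C m).
Proof.
apply: cnnP => q; rewrite piTnnE /nu /upow.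
have [<-|qm] := eqVneq ord_max q; first by rewrite !dsum_inj_in projT_hatN.
by rewrite !dsum_inj_out// linear0.
Qed.

Lemma piTnn_surj m (y : cnn (CT C) m) : exists x, piTnn x = y.
Proof.
exists (dsum_mk (V := fun q : 'I_m.+1 => C q) (fun q => repr (y q))).
by apply: cnnP => q; rewrite piTnnE dsum_mkE; apply: quo_class_repr.
Qed.

Lemma pilam_ran m (y : C m) : pilam C m (sub1T y) = 0.
Proof. by apply/quo_proj_eq0; exists (cycN y); rewrite /= sub1tau_cycN. Qed.

Definition pibar m : {linear cnn (CT C) m -> lam C m} :=
  quo_lift (pilam C m) (@pilam_ran m) \o @pi0nn k (CT C) m.

Lemma pibarE m (x : cnn C m) : pibar m (piTnn x) = pinn C m x.
Proof. rewrite /pibar /= /pi0nn piTnnE.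
exact: (quo_liftE (pilam C m) (@pilam_ran m)). Qed.

Lemma nu0nn_ran m (y : C m) : (@piTnn m \o nu0nn iota C m) (sub1tau y) = 0.
Proof.
rewrite /= piTnn_geom piTnn_nu.
suff -> : nu iota (projT (sub1tau y) : CT C m) = 0 by rewrite linear0.
rewrite /nu; suff -> : hatN iota (projT (sub1tau y) : CT C m) = 0.
  exact: (linear0 (@dsum_inj k _ (fun q : 'I_m.+1 => CT C q) ord_max)).
rewrite /hatN; have -> : hat iota (projT (sub1tau y) : CT C m) =
    sub1tau (hat iota (projT y : CT C m)).
  rewrite /sub1tau -!projT_hat -projT_tau -linearB; congr (projT _).
  rewrite /sub1tau (linearB (@hat k iota C m)) /=; congr (_ - _).
  by rewrite /hat (linearZ_LR (@tau k C m)).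
by rewrite cycN_sub1tau /sub1T cycT1 subrr.
Qed.

Definition nubar m : {linear lam C m -> cnn (CT C) m} :=
  quo_lift (@piTnn m \o nu0nn iota C m) (@nu0nn_ran m).

Lemma nubarE m (x : C m) : nubar m (pilam C m x) = piTnn (nu0nn iota C m x).
Proof. by rewrite /nubar quo_liftE. Qed.

(* The map induced by phinn of C is phinn of CT C: see phibarE. *)
Definition phibar m : {linear cnn (CT C) m -> cnn (CT C) m.+1} :=
  phinn iota (CT C) m.

Lemma phibarE m (x : cnn C m) : phibar m (piTnn x) = piTnn (phinn iota C m x).
Proof. by rewrite /phibar /= piTnn_geom piTnn_phi. Qed.
End Descent.

(* Main.v *)
Require Import Defs.
From mathcomp Require Import all_boot all_order all_algebra.

Set Implicit Arguments.
Unset Strict Implicit.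
Unset Printing Implicit Defensive.
Import GRing.Theory.
Local Open Scope ring_scope.

(** Each row of the double complex over [CT C], with differential [partial],
    contracts onto its homology, which is [lam C] placed at u^0; the total
    differential D = partial + delta is treated as a perturbation of [partial].

    In a row the contraction is explicit: the identity
    (1 - tau) hatD = 1 - hatN gives [partial_phi_homotopy],
      partial phi + phi partial = nu pi0 - 1.
    Let h = geom phi and nu' = geom nu, where geom inverts 1 - phi delta.
    The side conditions phi phi = 0 and phi nu = 0 of the usual perturbation
    lemma fail here, but they can be avoided.  Apply 1 - phi delta to
    G = 1 + D h + h D.  Since phi delta D = - phi partial D (because D D = 0)
    and (1 - phi delta) h = phi, this yields
      1 + D h + phi partial D h + phi partial,
    and the row identity turns phi partial D h into
    nu pi0 D h - D h - partial phi D h.  Two facts finish the computation: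
    nu pi0 D h = 0, because pi0 h = 0 and, over a precyclic module, hatN kills
    the range of 1 - tau; and partial phi D h = - partial phi, once more by the
    row identity ([partial_phi_dtot_phinn]).  What is left is
    1 + partial phi + phi partial = nu pi0, so G = nu' pi0 by [geom_unique]:
    this is the homotopy formula [nu0nn_homotopy], applied to [CT C].

    That the section is a chain map is then formal, since pi0 induces a
    surjective chain map onto [lam C] ([chain_map_of_homotopy]).  The remaining
    identities hold because h and the higher terms of nu' only involve positive
    powers of u, which pi0 discards, and because hatN is the identity modulo
    1 - tau. *)

(** * Averaging over the cyclic action *)

Section Averaging.
Variables (k : nzRingType) (iota : {rmorphism rat -> k}) (C : paraPrecyclic k).

Lemma hat_sum m (x : C m) : hat iota x *+ m.+1 = x.
Proof.
rewrite /hat -scaler_nat scalerA -(rmorph_nat iota) -rmorphM mulfV.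
  by rewrite rmorph1 scale1r.
by rewrite Num.Theory.pnatr_eq0.
Qed.

Lemma hat_cycN m (x : C m) : hat iota (cycN x) = hatN iota x.
Proof. by rewrite /hatN /hat linearZ. Qed.

Lemma hat_sub1tau m (x : C m) : hat iota (sub1tau x) = sub1tau (hat iota x).
Proof. by rewrite /hat (linearZ_LR (@sub1tau k C m)). Qed.

(** Summation by parts: each power of [tau] in (1 - tau) hatD telescopes to
    coefficient -1, except the constant term, whose coefficient is m. *)
Lemma sub1tau_hatD m (x : C m) : sub1tau (hatD iota x) = x - hatN iota x.
Proof.
rewrite -{2}[x]hat_sum /hatN /hatD; set y := hat iota x.
rewrite /sub1tau linear_sum /=.
under [X in _ - X]eq_bigr do rewrite linearMn /=.
rewrite /cycN big_ord_recl [in X in _ - X]big_ord_recr /= subn0 subnn mulr0n addr0.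
rewrite [in RHS]big_ord_recl /= mulrS opprD addrACA subrr add0r -addrA.
congr (_ + _); rewrite -sumrB -sumrN; apply: eq_bigr => j _.
by rewrite /= -(subnSK (ltn_ord j)) mulrS opprD addrCA subrr addr0.
Qed.

Lemma tau_hatD m (x : C m) : tau (hatD iota x) = hatD iota (tau x).
Proof.
rewrite /hatD linear_sum; apply: eq_bigr => j _.
rewrite linearMn /=; congr (_ *+ _).
by rewrite -iterS iterSr /hat (linearZ_LR (@tau k C m)).
Qed.

Lemma hatD_sub1tau m (x : C m) : hatD iota (sub1tau x) = x - hatN iota x.
Proof.
by rewrite -sub1tau_hatD /sub1tau (linearB (@hatD k iota C m)) /= tau_hatD.
Qed.

Lemma pilam_sub1tau m (x : C m) : pilam C m (sub1tau x) = 0.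
Proof. by apply/quo_proj_eq0; exists x. Qed.

(** [x - hatN x] lies in the range of 1 - tau by [sub1tau_hatD]. *)
Lemma pilam_hatN m (x : C m) : pilam C m (hatN iota x) = pilam C m x.
Proof.
apply/esym/eqP; rewrite -subr_eq0 -linearB -sub1tau_hatD.
by rewrite pilam_sub1tau.
Qed.

End Averaging.

(** * The geometric series in phi delta *)

Section GeometricSeries.
Variables (k : nzRingType) (iota : {rmorphism rat -> k}) (C : paraPrecyclic k).

Lemma geom_phidelta m (x : cnn C m) :
  geom iota x = x + phidelta iota (geom iota x).
Proof.
rewrite {2}/geom linear_sum big_ord_recr /= -iterS iter_phidelta0// addr0.
by rewrite /geom big_ord_recl.
Qed.

(** Telescoping: geom (x - phi delta x) = x by nilpotence of phi delta. *)
Lemma geom_unique m (x w : cnn C m) :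
  x - phidelta iota x = w -> x = geom iota w.
Proof.
move=> <-; rewrite linearB /= [X in _ - X]/geom.
under [X in _ - X]eq_bigr do rewrite -iterSr.
rewrite big_ord_recr /= -iterS iter_phidelta0// addr0.
by rewrite /geom big_ord_recl /= addrK.
Qed.

Lemma pi0nn_phi m (x : cnn C m) : pi0nn (phi iota x) = 0.
Proof. exact: phi_max. Qed.

Lemma pi0nn_phidelta m (x : cnn C m) : pi0nn (phidelta iota x) = 0.
Proof. by case: m x => [|m] x; [exact: (linear0 (@pi0nn k C 0)) | exact: pi0nn_phi]. Qed.

Lemma pi0nn_geom m (x : cnn C m) : pi0nn (geom iota x) = pi0nn x.
Proof. by rewrite geom_phidelta linearD /= pi0nn_phidelta addr0. Qed.

Lemma pi0nn_phinn m (x : cnn C m) : pi0nn (phinn iota C m x) = 0.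
Proof. by rewrite /= pi0nn_geom pi0nn_phi. Qed.

Lemma phinnE m (x : cnn C m) :
  phinn iota C m x = phi iota x + phi iota (delta (phinn iota C m x)).
Proof. exact: geom_phidelta. Qed.

Lemma pi0nn_nu m (x : C m) : pi0nn (nu iota x) = hatN iota x.
Proof. by rewrite /pi0nn /nu /upow dsum_inj_in. Qed.

Lemma nu_widen m (x : C m.+1) (q : 'I_m.+1) :
  nu iota x (widen_ord (leqnSn _) q) = 0.
Proof.
by rewrite /nu /upow dsum_inj_out// -val_eqE /= gtn_eqF.
Qed.

Lemma pi0nn_dtot m (x : cnn C m.+1) :
  pi0nn (dtot x) = sub1tau (x (widen_ord (leqnSn _) ord_max) : C m) + b (pi0nn x).
Proof.
rewrite /pi0nn /dtot cnnDE partialE deltaE /= subnn subSnn /=.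
congr (_ + b _); exact: (@cnn_irr k C m.+1 x m.+1).
Qed.

End GeometricSeries.

(** * The row contraction and its perturbation *)

Section RowContraction.
Variables (k : nzRingType) (iota : {rmorphism rat -> k}) (C : paraPrecyclic k).

Definition phipartial m : cnn C m -> cnn C m :=
  match m with
  | 0 => fun=> 0
  | n.+1 => fun x => phi iota (partial x)
  end.

(** In positive powers of u this combines (1 - tau) hatD = hatD (1 - tau) =
    1 - hatN with the summand hatN from the other term; at u^0 the second term
    is absent, and the defect hatN is [nu \o pi0nn]. *)
Lemma partial_phi_homotopy m (x : cnn C m) :
  partial (phi iota x) + phipartial x = nu iota (pi0nn x) - x.
Proof.
apply: cnnP => q; rewrite !cnnDE cnnNE partialE /= phi_widen.
have [->|] := eqVneq q ord_max.
  have -> : phipartial x ord_max = 0.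
    by case: m x {q} => [|m] x; [exact: cnn0E | exact: phi_max].
  rewrite -[nu _ _ ord_max]/(pi0nn (nu iota (pi0nn x))) pi0nn_nu addr0 /=.
  rewrite subSnn subnn /= (linearN (@sub1tau k C m)) /= sub1tau_hatD opprB.
  by [].
case: m x q => [|m] x q qm.
  by case/eqP: qm; apply: val_inj; case: q => -[].
case: (cnn_case q) qm => [[r ->] _|->]; last by rewrite eqxx.
rewrite /= phi_widen partialE nu_widen sub0r /= !subSn ?leqW -1?ltnS//= negbK.
move: {x q}(x _) => /= y; case: (odd _) => /=.
  suff main (z : C r) : sub1tau (- hatD iota z) + - hat iota (cycN z) = - z.
    exact (main y).
  by rewrite linearN /= sub1tau_hatD hat_cycN opprB addrAC subrr sub0r.
suff main (z : C r) : cycN (- hat iota z) + - hatD iota (sub1tau z) = - z.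
  exact (main y).
by rewrite linearN /= hatD_sub1tau opprB addrA addNr sub0r.
Qed.

End RowContraction.

Section Perturbation.
Variables (k : nzRingType) (iota : {rmorphism rat -> k}) (C : precyclic k).

Lemma partial_partial m (x : cnn C m.+2) : partial (partial x) = 0.
Proof.
apply: cnnP => q; rewrite cnn0E !partialE /= !subSn ?leqW -1?ltnS//= negbK.
move: (x _) => /= y; case: (odd _) => /=.
  by rewrite (cycN_sub1tau (y : C q)) /sub1T cycT1 subrr.
by rewrite (sub1tau_cycN (y : C q)) /sub1T cycT1 subrr.
Qed.

Lemma partial_nu m (x : C m.+1) : partial (nu iota x) = 0.
Proof. exact: partial_upow0. Qed.

Lemma nu_sub1tau m (x : C m) : nu iota (sub1tau x) = 0.
Proof.
rewrite /nu /hatN hat_sub1tau cycN_sub1tau /sub1T cycT1 subrr.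
exact: (linear0 (@dsum_inj k _ (fun q : 'I_m.+1 => C q) ord_max)).
Qed.

Lemma nu_pi0nn_dtot m (x : cnn C m.+1) :
  nu iota (pi0nn (dtot x)) = nu iota (b (pi0nn x)).
Proof. by rewrite pi0nn_dtot linearD /= nu_sub1tau add0r. Qed.

(** This is phi D^2 = 0; it trades phi delta for - phi partial on the image
    of D. *)
Lemma phidelta_dtot m (x : cnn C m.+1) :
  phidelta iota (dtot x) = - phipartial iota (dtot x).
Proof.
apply/eqP; rewrite -addr_eq0; apply/eqP.
case: m x => [|m] x /=; first by rewrite addr0.
by rewrite -linearD /= addrC -/(dtot (dtot x)) dtot_dtot linear0.
Qed.

(** Splitting D = partial + delta, the row identity and partial nu = 0 give
    partial phi partial h = - partial h, while phi delta h = h - phi. *)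
Lemma partial_phi_dtot_phinn m (x : cnn C m) :
  partial (phi iota (dtot (phinn iota C m x))) = - partial (phi iota x).
Proof.
set h := phinn iota C m x.
have hE : phi iota (delta h) = h - phi iota x.
  by rewrite [in RHS]/h phinnE -/h addrC addKr.
have pE : phi iota (partial h) = nu iota (pi0nn h) - h - partial (phi iota h).
  by rewrite -partial_phi_homotopy addrC addKr.
rewrite /dtot !linearD /= hE pE !linearB /= partial_partial partial_nu.
by rewrite sub0r subr0 addKr.
Qed.

Lemma nu0nn_homotopy m (x : cnn C m) :
  nu0nn iota C m (pi0nn x) =
  x + @dh_hd k (cnn_complex C) (phinn iota C) m x.
Proof.
apply/esym/geom_unique.
pose Dh := dtot (phinn iota C m x).
(* (1 - phi delta) h D = phi D = phi partial + phi delta, and the phi delta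
   cancels against the one in (1 - phi delta) 1 *)
have -> : x + @dh_hd k (cnn_complex C) (phinn iota C) m x -
    phidelta iota (x + @dh_hd k (cnn_complex C) (phinn iota C) m x) =
    x + Dh - phidelta iota Dh + phipartial iota x.
  rewrite /Dh; case: m x {Dh} => [|m] x; first by rewrite !subr0 addr0.
  rewrite /=; set hD := geom iota (phi iota (dtot x)).
  have hDE : hD = phi iota (dtot x) + phidelta iota hD by exact: geom_phidelta.
  move: (dtot (geom _ _)) => Dh.
  rewrite {1}hDE {1}[dtot x]/dtot !linearD /=; clearbody hD.
  move: (phi iota (delta _)) (phi iota (delta _)) (phi iota (delta _)) => u v w.
  rewrite -!opprD; apply/eqP; rewrite subr_eq; apply/eqP.
  by rewrite !addrA (addrAC _ w u) (addrAC _ _ u) subrK.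
have phipartialE (y : cnn C m) :
    phipartial iota y = nu iota (pi0nn y) - y - partial (phi iota y).
  by rewrite -partial_phi_homotopy addrC addKr.
rewrite phidelta_dtot opprK !phipartialE -/Dh.
have -> : nu iota (pi0nn Dh) = 0.
  by rewrite nu_pi0nn_dtot pi0nn_phinn linear0 linear0.
rewrite partial_phi_dtot_phinn opprK sub0r /=.
clearbody Dh; move: (partial _) (nu _ _) => p v.
rewrite !addrA addrK; apply/eqP; rewrite !subr_eq.
by rewrite [x + p]addrC [eqbLHS]addrC addrA.
Qed.

End Perturbation.

(** * The retraction *)

(** As p is onto, it suffices to compare the two sides on the image of p,
    where s b p = s p D = D + D h D = D s p by D^2 = 0. *)
Lemma chain_map_of_homotopy (k : nzRingType) (X Y : chainComplex k)
    (p : forall m, {linear X m -> Y m}) (s : forall m, {linear Y m -> X m})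
    (h : forall m, {linear X m -> X m.+1}) :
  is_chain_map p -> (forall m (y : Y m), exists x, p m x = y) ->
  (forall m (x : X m), s m (p m x) = x + dh_hd h x) -> is_chain_map s.
Proof.
move=> p_chain p_surj homot m y; have [x <-] := p_surj _ y.
rewrite p_chain !homot /= !linearD /= dif_dif add0r.
by case: m x {y} => [|m] x //=; rewrite dif_dif linear0 addr0.
Qed.

Section Retraction.
Variables (k : nzRingType) (iota : {rmorphism rat -> k}) (C : paraPrecyclic k).

Lemma pibar_piTnn m (x : cnn C m) : pibar C m (piTnn x) = pilam C m (pi0nn x).
Proof. exact: pibarE. Qed.

Lemma pibar_surj m (y : lam C m) : exists x, pibar C m x = y.
Proof.
have [z <-] := quo_proj_surj y.
by exists (piTnn (upow (q := ord_max) z)); rewrite pibarE /= /pi0nn /upow dsum_inj_in.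
Qed.

(** Passing to [CT C] commutes with every ingredient of [nu0nn], so the
    homotopy formula for the precyclic module [CT C] applies. *)
Lemma nubar_pibar m (x : cnn (CT C) m) :
  nubar iota C m (pibar C m x) = nu0nn iota (CT C) m (pi0nn x).
Proof.
have [z <-] := piTnn_surj x.
by rewrite pibar_piTnn nubarE /= piTnn_geom piTnn_nu /pi0nn piTnnE.
Qed.

Lemma pibar_nubar m (y : lam C m) : pibar C m (nubar iota C m y) = y.
Proof.
have [x <-] := quo_proj_surj y.
by rewrite nubarE pibarE /= pi0nn_geom pi0nn_nu pilam_hatN.
Qed.

Lemma nubar_pibar_homotopy m (x : cnn (CT C) m) :
  nubar iota C m (pibar C m x) =
  x + @dh_hd k (cnn_complex (CT C)) (phibar iota C) m x.
Proof. by rewrite nubar_pibar nu0nn_homotopy. Qed.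

Lemma pibar_phibar m (x : cnn (CT C) m) :
  pibar C m.+1 (phibar iota C m x) = 0.
Proof.
have [z <-] := piTnn_surj x.
by rewrite phibarE pibarE /pinn /= pi0nn_geom pi0nn_phi linear0.
Qed.

Lemma piTnn_partial m (x : cnn C m.+1) : piTnn (partial x) = partial (piTnn x).
Proof.
apply: cnnP => q; rewrite piTnnE !partialE /= piTnnE.
by case: ifP => _; rewrite ?projT_cycN// /sub1tau linearB /= projT_tau.
Qed.

Lemma pibar_chain_map :
  @is_chain_map k (cnn_complex (CT C)) (lam_complex C) (pibar C).
Proof.
move=> m x; have [z <-] := piTnn_surj x.
rewrite -[RHS]/(pibar C m (dtot (piTnn z))).
rewrite -[LHS]/(lam_b C m (pibar C m.+1 (piTnn z))).
have -> : dtot (piTnn z) = piTnn (dtot z).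
  by rewrite /dtot linearD /= piTnn_partial piTnn_delta.
rewrite !pibar_piTnn lam_bE pi0nn_dtot linearD /=.
by rewrite pilam_sub1tau add0r.
Qed.

Lemma nubar_chain_map :
  @is_chain_map k (lam_complex C) (cnn_complex (CT C)) (nubar iota C).
Proof.
apply: (chain_map_of_homotopy pibar_chain_map pibar_surj).
exact: nubar_pibar_homotopy.
Qed.

End Retraction.

Theorem proposition9p5 (k : nzRingType) (iota : {rmorphism rat -> k})
    (C : paraPrecyclic k) :
  [/\ @is_chain_map k (lam_complex C) (cnn_complex (CT C)) (nubar iota C),
      forall m (y : lam C m), pibar C m (nubar iota C m y) = y,
      forall m (x : cnn (CT C) m),
        nubar iota C m (pibar C m x)
        = x + @dh_hd k (cnn_complex (CT C)) (phibar iota C) m x,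
      forall m (x : cnn (CT C) m), pibar C m.+1 (phibar iota C m x) = 0
    & @deformation_retract k (cnn_complex (CT C)) (lam_complex C)
        (pibar C) (nubar iota C) (phibar iota C)].
Proof.
split; first exact: nubar_chain_map.
- exact: pibar_nubar.
- exact: nubar_pibar_homotopy.
- exact: pibar_phibar.
split; first exact: pibar_chain_map.
- exact: nubar_chain_map.
- exact: pibar_nubar.
- exact: nubar_pibar_homotopy.
Qed.
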